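(* Let $\mathcal{A}$ be an infinite Boolean algebra. If $\mathcal{A}$ carries an anti-Nikodym sequence of measures which has a strong Nikodym concentration point in $St(\mathcal{A})$, then there are an anti-Nikodym sequence $(\nu_k)_{k\in\omega}$ of measures on $\mathcal{A}$ and an antichain $(B_k)_{k\in\omega}$ in $\mathcal{A}$ such that for every $k\in\omega$: $\operatorname{supp}(\widehat{\nu}_k)\subseteq[B_k]$ and $\|\nu_k\|>k$.
   Context: A measure on a Boolean algebra $\mathcal{A}$ is a finitely additive $\mu\colon\mathcal{A}\to\mathbb{R}$ with finite variation norm $\|\mu\|=\sup\{|\mu(A)|+|\mu(B)|\colon A\wedge B=0\}$; $\mu\restriction A$ denotes $B\mapsto\mu(A\wedge B)$. $St(\mathcal{A})$ is the Stone space, $[A]$ the clopen set of ultrafilters containing $A$, and $\widehat\mu$ the Radon extension of $\mu$ to $St(\mathcal{A})$; $\operatorname{supp}$ is the support (smallest closed set of full variation). An antichain is a sequence of pairwise disjoint ($A_i\wedge A_j=0$) elements. A sequence $(\mu_n)$ is anti-Nikodym if $\lim_n\mu_n(A)=0$ for all $A\in\mathcal{A}$ and $\sup_n\|\mu_n\|=\infty$. $t\in St(\mathcal{A})$ is a strong Nikodym concentration point of $(\mu_n)$ if for every $N\in\omega$ and $A\in\mathcal{A}$ with $t\in[A]$ there are a clopen $U\subseteq[A]\setminus\{t\}$ and $n$ with $|\widehat\mu_n(U)|>N(\|\mu_n\restriction A^c\|+1)$. *)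

(* Defs.v *)
From HB Require Import structures.
From mathcomp Require Import all_boot all_order all_algebra.
From mathcomp Require Import all_classical all_reals all_analysis.

Set Implicit Arguments.
Unset Strict Implicit.
Unset Printing Implicit Defensive.

Import Order.TTheory GRing.Theory Num.Theory.
Import numFieldNormedType.Exports.

Local Open Scope classical_set_scope.
Local Open Scope ring_scope.

(** Boolean algebras are the complemented distributive lattices with top and
    bottom; their operations are written in [order_scope]. *)

Section Measures.
Context {d : Order.disp_t} {A : ctbDistrLatticeType d} {R : realType}.
Implicit Types (a b : A) (mu : A -> R).

Definition variation_norm mu : \bar R :=
  ereal_sup [set x | exists a b,
    (a `&` b = \bot)%O /\ x = (`|mu a| + `|mu b|)%:E].

Definition is_measure mu : Prop :=
  (forall a b, (a `&` b = \bot)%O -> mu (a `|` b)%O = mu a + mu b) /\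
  (variation_norm mu < +oo)%E.

Definition mrestrict mu a : A -> R := fun b => mu (a `&` b)%O.

Definition antichain (B : nat -> A) : Prop :=
  forall i j, i <> j -> (B i `&` B j = \bot)%O.

Definition anti_nikodym (mu : nat -> A -> R) : Prop :=
  [/\ forall n, is_measure (mu n),
      forall a, mu n a @[n --> \oo] --> (0 : R)
    & ereal_sup (range (fun n => variation_norm (mu n))) = +oo%E].

End Measures.

Section StoneSpace.
Context {d : Order.disp_t} (A : ctbDistrLatticeType d).

Definition is_ultrafilter (F : set A) : Prop :=
  [/\ F \top%O /\ ~ F \bot%O,
      forall a b, F a -> F b -> F (a `&` b)%O,
      forall a b, (a <= b)%O -> F a -> F b
    & forall a, F a \/ F (~` a)%O].

Definition stone : Type := {F : set A | is_ultrafilter F}.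

HB.instance Definition _ := gen_eqMixin stone.
HB.instance Definition _ := gen_choiceMixin stone.

(** The set [[a]] of ultrafilters containing [a]. *)
Definition stone_set (a : A) : set stone := [set t | sval t a].

(** The topology having the sets [stone_set a] as a base. *)
Definition stone_open : set (set stone) :=
  [set U | forall t, U t -> exists2 a, stone_set a t & stone_set a `<=` U].

Lemma stone_openT : stone_open setT.
Proof. by move=> t _; exists \top%O => //; case: (svalP t) => -[]. Qed.

Lemma stone_openI : setI_closed stone_open.
Proof.
move=> U V oU oV t [/oU[a ta aU] /oV[b tb bV]]; exists (a `&` b)%O.
  by case: (svalP t) => _ tI _ _; apply: tI.
by move=> s; case: (svalP s) => _ _ le_s _ sab; split;
  [apply: aU|apply: bV]; apply: le_s sab; [apply: leIl|apply: leIr].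
Qed.

Lemma stone_open_bigU (I : Type) (f : I -> set stone) :
  (forall i, stone_open (f i)) -> stone_open (\bigcup_i f i).
Proof.
by move=> of_ t [i _ /of_[a ta af]]; exists a => // s /af; exists i.
Qed.

HB.instance Definition _ :=
  isOpenTopological.Build stone stone_openT stone_openI stone_open_bigU.

End StoneSpace.

(** Real-valued Borel measures on a topological space. The measurable types of
    the library are pointed, while a Stone space may be empty, hence the direct
    definition over the Borel sigma-algebra. *)
Section SignedBorel.
Context {T : topologicalType} {R : realType}.
Implicit Types (m : set T -> R) (E F : set T).

Definition borel : set (set T) := <<s (@open T) >>.

Definition is_signed_borel m : Prop :=
  forall F : nat -> set T, (forall i, borel (F i)) -> trivIset setT F ->
    (\sum_(0 <= i < n) m (F i)) @[n --> \oo] --> m (\bigcup_i F i).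

Definition total_variation m E : \bar R :=
  ereal_sup [set x | exists B C, [/\ borel B, borel C, B `<=` E, C `<=` E &
    B `&` C = set0 /\ x = (`|m B| + `|m C|)%:E]].

(** Finiteness of the variation is automatic for real-valued [m]. *)
Definition is_radon m : Prop :=
  is_signed_borel m /\
  forall E (e : R), borel E -> 0 < e ->
    exists K, [/\ compact K, borel K, K `<=` E &
      (total_variation m (E `\` K) < e%:E)%E].

Definition radon_support m : set T :=
  \bigcap_(F in [set F | closed F /\
                   total_variation m F = total_variation m setT]) F.

End SignedBorel.

Section RadonExtension.
Context {d : Order.disp_t} {A : ctbDistrLatticeType d} {R : realType}.

Definition is_radon_extension (mu : A -> R) (m : set (stone A) -> R) : Prop :=
  is_radon m /\ forall a, m (stone_set a) = mu a.

(** For a measure [mu] an extension exists, and any two of them agree on Borel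
    sets, the only sets on which the values of [radon_extension mu] are used. *)
Definition radon_extension (mu : A -> R) : set (stone A) -> R :=
  xget (fun=> 0) (is_radon_extension mu).

Definition strong_nikodym_point (mu : nat -> A -> R) (t : stone A) : Prop :=
  forall (N : nat) (a : A), stone_set a t ->
    exists (U : set (stone A)) (n : nat),
      [/\ clopen U, U `<=` stone_set a `\` [set t] &
        (N%:R%:E * (variation_norm (mrestrict (mu n) (~` a)%O) + 1)
          < `|radon_extension (mu n) U|%:E)%E].

End RadonExtension.

(* Main.v *)
(** Let [t] be a strong Nikodym concentration point of [(mu_n)]. Rescaling
    members of the sequence and shrinking around [t], one obtains measures
    [lam_k], still converging pointwise to [0], and pairwise disjoint [c_k] not
    containing [t], such that [lam_k] is large on some element below [c_k] but
    small on every element that is disjoint from [c_k] and does not contain [t].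
    Up to a small error, [lam_k] thus lives on [c_k] and on an atom at [t]. A
    combination of [lam_(2k)] and [lam_(2k+1)] with coefficients of maximal
    modulus [1] cancels the two atoms and remains large on [c_(2k)] or
    [c_(2k+1)]; restricting it to [B_k], the join of the two, changes it by a
    quantity tending to [0] uniformly. *)

From mathcomp Require Import all_boot all_order all_algebra.
From mathcomp Require Import all_classical all_reals all_analysis.
From mathcomp Require Import lra zify.
Require Import Defs.

Set Implicit Arguments.
Unset Strict Implicit.
Unset Printing Implicit Defensive.

Import Order.Theory GRing.Theory Num.Theory.
Import numFieldNormedType.Exports.
Local Open Scope classical_set_scope.
Local Open Scope ring_scope.

Section StoneSpace.
Context {d : Order.disp_t} {A : ctbDistrLatticeType d}.
Implicit Types (a b : A) (t : stone A) (K V : set (stone A)).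

Lemma stone_setT : stone_set \top%O = [set: stone A].
Proof. by apply/seteqP; split=> // t _; case: (svalP t) => -[]. Qed.

Lemma stone_set0 : stone_set \bot%O = set0 :> set (stone A).
Proof. by apply/seteqP; split=> // t; case: (svalP t) => -[]. Qed.

Lemma stone_setS a b : (a <= b)%O -> stone_set a `<=` stone_set b.
Proof. by move=> ab t; case: (svalP t) => _ _ + _; apply. Qed.

Lemma stone_setI a b : stone_set (a `&` b)%O = stone_set a `&` stone_set b.
Proof.
apply/seteqP; split=> t; last by case: (svalP t) => _ tI _ _ [ta]; apply: tI.
by move=> tab; split; apply: stone_setS tab; rewrite ?leIl ?leIr.
Qed.

Lemma stone_setC a : stone_set (~` a)%O = ~` stone_set a.
Proof.
apply/seteqP; split=> t; last by case: (svalP t) => _ _ _ /(_ a)[].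
move=> tNa ta; suff : (@set0 (stone A)) t by [].
by rewrite -stone_set0 -(meetxC a) stone_setI.
Qed.

Lemma stone_setU a b : stone_set (a `|` b)%O = stone_set a `|` stone_set b.
Proof.
by rewrite -(complK (a `|` b)%O) complU stone_setC stone_setI !stone_setC
  setCI !setCK.
Qed.

Lemma open_stone_set a : open (stone_set a).
Proof. by move=> t ta; exists a. Qed.

Lemma closed_stone_set a : closed (stone_set a).
Proof. by rewrite -openC -stone_setC; apply: open_stone_set. Qed.

Lemma stone_hausdorff : hausdorff_space (stone A).
Proof.
rewrite open_hausdorff => s t st.
have [a sa ta] : exists2 a, stone_set a s & ~ stone_set a t.
  apply: contrapT => /forall2NP le_st; move/eqP: st; apply.
  apply: eq_sig_hprop => [x p q|]; first exact: Prop_irrelevance.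
  have {}le_st a : stone_set a s -> stone_set a t.
    by move=> sa; have [//|/contrapT] := le_st a.
  apply/seteqP; split=> a; first exact: le_st.
  apply: contraPP => nsa; have : stone_set (~` a)%O s by rewrite stone_setC.
  by move=> /le_st; rewrite stone_setC.
exists (stone_set a, stone_set (~` a)%O); first by rewrite !inE stone_setC.
split; [exact: open_stone_set|exact: open_stone_set|].
by rewrite stone_setC setICr.
Qed.

Lemma stone_compact : compact [set: stone A].
Proof.
rewrite compact_ultra => F FU _.
have F_ultra : is_ultrafilter [set a : A | F (stone_set a)].
  split=> /=.
  - rewrite stone_setT stone_set0.
    by split; [exact: filterT|exact: filter_not_empty].
  - by move=> a b Fa Fb; rewrite stone_setI; apply: filterI.
  - by move=> a b ab; apply: filterS; apply: stone_setS.
  - by move=> a; rewrite stone_setC; apply: in_ultra_setVsetC.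
exists (exist _ _ F_ultra); split=> // V; rewrite nbhsE => -[W [oW Wt] WV].
have [a Fa aW] := oW _ Wt.
by apply: filterS Fa => t /aW /WV.
Qed.

Lemma compact_stone_set_between K V : compact K -> open V -> K `<=` V ->
  exists2 b, K `<=` stone_set b & stone_set b `<=` V.
Proof.
rewrite compact_near_coveringP => cK oV KV.
pose above b0 := [set b | (b0 <= b)%O /\ stone_set b `<=` V].
pose F := [set S | exists2 b0, stone_set b0 `<=` V & above b0 `<=` S].
have FF : Filter F.
  split=> [|P Q [a aV aP] [b bV bQ]|P Q PQ [b bV bP]].
  - by exists \bot%O; rewrite ?stone_set0.
  - exists (a `|` b)%O; first by rewrite stone_setU subUset.
    move=> c [+ cV]; rewrite leUx => /andP[ac bc].
    by split; [apply: aP|apply: bQ].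
  - by exists b => //; apply: subset_trans PQ.
have [x Kx|b bV /(_ b) Kb] := cK _ F (fun b x => stone_set b x) FF.
  have [a xa aV] := oV _ (KV _ Kx).
  exists (stone_set a, above a) => /=.
    split; last by exists a.
    by apply: open_nbhs_nbhs; split=> //; exact: open_stone_set.
  by move=> [y b] [/= ya [ab _]]; apply: stone_setS ya.
by exists b => //; apply: Kb.
Qed.

Lemma clopen_stone_set V : clopen V -> exists b, V = stone_set b.
Proof.
move=> [oV cV]; have cptV := subclosed_compact cV stone_compact (@subsetT _ V).
have [b Vb bV] := compact_stone_set_between cptV oV (@subset_refl _ V).
by exists b; apply/seteqP.
Qed.

End StoneSpace.

Section SignedBorelMeasures.
Context {T : topologicalType} {R : realType}.
Implicit Types (m : set T -> R) (E F : set T).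

Lemma borel0 : borel (set0 : set T).
Proof. exact: sigma_algebra0. Qed.

Lemma borel_open E : open E -> borel E.
Proof. exact: sub_gen_smallest. Qed.

Lemma borelC E : borel E -> borel (~` E).
Proof. by rewrite -setTD; apply: sigma_algebraCD. Qed.

Lemma borel_closed E : closed E -> borel E.
Proof. by rewrite -openC => /borel_open/borelC; rewrite setCK. Qed.

Lemma borelI E F : borel E -> borel F -> borel (E `&` F).
Proof.
have /sigma_algebraP[//|_ _ _] := smallest_sigma_algebra setT (@open T).
by apply.
Qed.

Lemma borelD E F : borel E -> borel F -> borel (E `\` F).
Proof. by rewrite setDE => bE /borelC; apply: borelI. Qed.

Lemma signed_borel0 m : is_signed_borel m -> m set0 = 0.
Proof.
move=> /(_ (fun=> set0) (fun=> borel0)).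
have disj0 : trivIset setT (fun _ : nat => set0 : set T).
  by apply/trivIsetP => i j _ _ _; rewrite setI0.
rewrite bigcup0// => /(_ disj0) /cvgP/cvg_series_cvg_0/cvg_lim.
by rewrite lim_cst// => ->.
Qed.

Lemma signed_borelU m E F : is_signed_borel m -> borel E -> borel F ->
  E `&` F = set0 -> m (E `|` F) = m E + m F.
Proof.
move=> mm bE bF EF0; rewrite -bigcup2E.
have bEF i : borel (bigcup2 E F i) by case: i => [|[|i]] //=; exact: borel0.
have tEF : trivIset setT (bigcup2 E F) by rewrite -trivIset_bigcup2.
rewrite -(cvg_lim (@Rhausdorff R) (mm _ bEF tEF)).
apply: (cvg_lim (@Rhausdorff R)); rewrite -(cvg_shiftn 2).
apply: cvg_near_cst; near=> n.
rewrite /= addn2 !big_nat_recl//= big1 ?addr0// => i _; exact: signed_borel0.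
Unshelve. all: by end_near. Qed.

Lemma signed_borelDI m E F : is_signed_borel m -> borel E -> borel F ->
  m E = m (E `\` F) + m (E `&` F).
Proof.
move=> mm bE bF; rewrite -{1}(setUIDK E F) setUC signed_borelU//.
- exact: borelD.
- exact: borelI.
- by apply/seteqP; split=> // x [[_ nFx] []].
Qed.

Lemma norm_le_total_variation m E F : is_signed_borel m -> borel E ->
  E `<=` F -> (`|m E|%:E <= total_variation m F)%E.
Proof.
move=> mm bE EF; apply: ereal_sup_ubound; exists E, set0.
by split=> //; [exact: borel0|rewrite setI0 signed_borel0// normr0 addr0].
Qed.

Lemma radon_support_subset m F : closed F -> is_signed_borel m ->
  (forall E, borel E -> E `<=` ~` F -> m E = 0) -> radon_support m `<=` F.
Proof.
move=> cF mm mF; have bF := borel_closed cF.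
apply: bigcap_inf; split=> //; apply/eqP; rewrite eq_le.
apply/andP; split; apply: ge_ereal_sup => x [B [C [bB bC BF CF [BC0 ->]]]].
  by apply: ereal_sup_ubound; exists B, C.
apply: ereal_sup_ubound; exists (B `&` F), (C `&` F).
split; [exact: borelI|exact: borelI|exact: subIsetr|exact: subIsetr|].
split; first by rewrite setIACA BC0 set0I.
have mI E : borel E -> m E = m (E `&` F).
  by move=> bE; rewrite (signed_borelDI mm bE bF) mF ?add0r//; exact: borelD.
by rewrite -!mI.
Qed.

End SignedBorelMeasures.

Section RadonMeasuresOnStoneSpaces.
Context {d : Order.disp_t} {A : ctbDistrLatticeType d} {R : realType}.
Implicit Types (a b : A) (mu : A -> R) (m : set (stone A) -> R).

Lemma radon_stone_set_approx m (E V : set (stone A)) (e : R) : is_radon m ->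
  borel E -> open V -> E `<=` V -> 0 < e ->
  exists2 b, stone_set b `<=` V & `|m E - m (stone_set b)| < e.
Proof.
move=> [mm m_reg] bE oV EV e_gt0; have e2_gt0 : 0 < e / 2 by rewrite divr_gt0.
have bV := borel_open oV.
have [K [cK _ KE Ke]] := m_reg E _ bE e2_gt0.
have [L [cL _ LE Le]] := m_reg (V `\` E) _ (borelD bV bE) e2_gt0.
have [b Kb bVL] : exists2 b, K `<=` stone_set b & stone_set b `<=` V `\` L.
  apply: compact_stone_set_between => //.
    rewrite setDE; apply: openI => //.
    by apply: closed_openC; apply: compact_closed cL; exact: stone_hausdorff.
  by move=> t /KE Et; split=> [|/LE[_]//]; apply: EV.
exists b; first by move=> t /bVL[].
have bb : borel (stone_set b) by apply: borel_open; exact: open_stone_set.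
have small_diff (F G H : set (stone A)) : borel F -> F `<=` G `\` H ->
    (total_variation m (G `\` H) < (e / 2)%:E)%E -> `|m F| < e / 2.
  move=> bF FGH; rewrite -lte_fin; apply: le_lt_trans.
  exact: norm_le_total_variation.
have m_Eb : `|m (E `\` stone_set b)| < e / 2.
  by apply: small_diff Ke => [|t [Et bt]]; [exact: borelD|split=> // /Kb].
have m_bE : `|m (stone_set b `\` E)| < e / 2.
  apply: small_diff Le => [|t [bt Et]]; first exact: borelD.
  by have [Vt Lt] := bVL _ bt; split.
rewrite (signed_borelDI mm bE bb) (signed_borelDI mm bb bE) setIC.
rewrite opprD addrACA subrr addr0 (splitr e).
by apply: le_lt_trans (ltrD m_Eb m_bE); apply: ler_normB.
Qed.

Lemma radon_eq0 m (V : set (stone A)) : is_radon m -> open V ->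
  (forall b, stone_set b `<=` V -> m (stone_set b) = 0) ->
  forall E, borel E -> E `<=` V -> m E = 0.
Proof.
move=> rm oV mV E bE EV; apply/eqP; rewrite -normr_le0.
apply/ler_addgt0Pl => e e_gt0; rewrite addr0.
have [b /mV mb /ltW] := radon_stone_set_approx rm bE oV EV e_gt0.
by rewrite mb subr0.
Qed.

(* Covering the default value [0] of [radon_extension] makes the existence of
   Radon extensions unnecessary in what follows. *)
Lemma radon_extensionP mu :
  is_radon_extension mu (radon_extension mu) \/ radon_extension mu = (fun=> 0).
Proof.
have [ex|nex] := pselect (exists m, is_radon_extension mu m).
  by left; apply: xgetPex.
by right; apply: xgetPN => m mu_m; apply: nex; exists m.
Qed.

Lemma radon_support_extension_subset mu a :
  (forall x, mu (x `\` a)%O = 0) ->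
  radon_support (radon_extension mu) `<=` stone_set a.
Proof.
move=> mua; apply: radon_support_subset; first exact: closed_stone_set.
  have [[[]//]|-> F _ _] := radon_extensionP mu.
  by under eq_fun do rewrite big1//; exact: cvg_cst.
move=> E bE Ea; have [[rm mE]|->//] := radon_extensionP mu.
apply: (radon_eq0 rm _ _ bE Ea) => [|b ba].
  by apply: closed_openC; exact: closed_stone_set.
suff -> : stone_set b = stone_set (b `\` a)%O by rewrite mE mua.
by rewrite diffE stone_setI stone_setC; apply/esym/setIidl.
Qed.

End RadonMeasuresOnStoneSpaces.

Section Measures.
Context {d : Order.disp_t} {A : ctbDistrLatticeType d} {R : realType}.
Implicit Types (a b x : A) (mu : A -> R).

Lemma le_variation_norm mu x : (`|mu x|%:E <= variation_norm mu)%E.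
Proof.
apply: (@le_trans _ _ (`|mu x| + `|mu \bot%O|)%:E).
  by rewrite lee_fin lerDl.
by apply: ereal_sup_ubound; exists x, \bot%O; rewrite meetx0.
Qed.

Lemma le_variation_norm_mrestrict mu a x : (x <= a)%O ->
  (`|mu x|%:E <= variation_norm (mrestrict mu a))%E.
Proof.
by move=> /meet_idPr xa; have := le_variation_norm (mrestrict mu a) x;
  rewrite /mrestrict xa.
Qed.

Lemma is_measureP mu : is_measure mu <->
  (forall a b, (a `&` b = \bot)%O -> mu (a `|` b)%O = mu a + mu b) /\
  exists C, forall x, `|mu x| <= C.
Proof.
split=> -[muU].
  move=> mu_fin; split=> //; exists (fine (variation_norm mu)) => x.
  have := le_variation_norm mu x; move: mu_fin.
  by case: (variation_norm mu) => [r _|//|_]; rewrite ?lee_fin ?leeNy_eq.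
move=> [C muC]; split=> //.
apply: (@le_lt_trans _ _ (C + C)%:E); last exact: ltry.
by apply: ge_ereal_sup => _ [a [b [_ ->]]]; rewrite lee_fin lerD.
Qed.

Lemma measure0 mu : is_measure mu -> mu \bot%O = 0.
Proof.
move=> [muU _]; apply: (@addrI _ (mu \bot%O)).
by rewrite -muU ?meetxx// joinxx addr0.
Qed.

Lemma measure_splitC mu a x : is_measure mu ->
  mu x = mu (x `&` a)%O + mu (x `&` ~` a)%O.
Proof.
move=> [muU _]; rewrite -muU; first by rewrite -meetUr joinxC meetx1.
by rewrite meetACA meetxC meetx0.
Qed.

Lemma is_measureZ (r : R) mu : is_measure mu -> is_measure (r *: mu).
Proof.
move=> /is_measureP[muU [C muC]]; apply/is_measureP; split=> [a b ab|].
  by rewrite !fctE muU// scalerDr.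
by exists (`|r| * C) => x; rewrite normrM ler_wpM2l.
Qed.

Lemma is_measureB mu mu' : is_measure mu -> is_measure mu' ->
  is_measure (mu - mu').
Proof.
move=> /is_measureP[muU [C muC]] /is_measureP[mu'U [C' mu'C]].
apply/is_measureP; split=> [a b ab|].
  by rewrite !fctE muU// mu'U// opprD addrACA.
by exists (C + C') => x; apply: le_trans (ler_normB _ _) _; exact: lerD.
Qed.

Lemma is_measure_mrestrict mu a : is_measure mu -> is_measure (mrestrict mu a).
Proof.
move=> /is_measureP[muU [C muC]]; apply/is_measureP; split=> [x y xy|].
  by rewrite /mrestrict meetUr muU// meetACA xy meetx0.
by exists C => x; apply: muC.
Qed.

Lemma radon_support_mrestrict mu a : is_measure mu ->
  radon_support (radon_extension (mrestrict mu a)) `<=` stone_set a.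
Proof.
move=> mmu; apply: radon_support_extension_subset => x.
by rewrite /mrestrict diffKI measure0.
Qed.

Lemma measures_bounded (mu : nat -> A -> R) k : (forall n, is_measure (mu n)) ->
  exists2 C, 0 <= C & forall n x, (n < k)%N -> `|mu n x| <= C.
Proof.
move=> mmu; have /choice[C muC] n : exists C, forall x, `|mu n x| <= C.
  by have /is_measureP[_] := mmu n.
exists (\big[Num.max/0]_(n < k) C n); first exact: bigmax_ge_id.
move=> n x nk; apply: le_trans (muC n x) _.
exact: (le_bigmax _ (fun i : 'I_k => C i) (Ordinal nk)).
Qed.

Lemma anti_nikodym_unbounded (mu : nat -> A -> R) :
  (forall k, is_measure (mu k)) ->
  (forall x, mu k x @[k --> \oo] --> (0 : R)) ->
  (forall k, k%:R%:E < variation_norm (mu k))%E -> anti_nikodym mu.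
Proof.
move=> mmu mu0 mu_big; split=> //; apply/eqyP => M _.
apply: (@le_trans _ _ (variation_norm (mu (Num.truncn M).+1))).
  by apply/ltW/(lt_trans _ (mu_big _)); rewrite lte_fin; exact: truncnS_gt.
by apply: ereal_sup_ubound; exists (Num.truncn M).+1.
Qed.

End Measures.

Section Antichains.
Context {d : Order.disp_t} {A : ctbDistrLatticeType d}.
Implicit Types (a c : nat -> A).

Lemma antichain_lt c :
  (forall i j, (i < j)%N -> (c i `&` c j = \bot)%O) -> antichain c.
Proof.
move=> c_lt i j /eqP; rewrite neq_ltn => /orP[/c_lt//|/c_lt].
by rewrite meetC.
Qed.

Lemma antichain_decreasing_diff a : (forall k, a k.+1 <= a k)%O ->
  antichain (fun k => a k `\` a k.+1)%O.
Proof.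
move=> /nonincreasing_seqP a_dec; apply: antichain_lt => i j ij.
apply/eqP; rewrite meetC disj_leC complB diffE.
by apply: lexUr; apply: leIxl; apply: a_dec.
Qed.

Lemma antichain_join_pairs c : antichain c ->
  antichain (fun k => c k.*2 `|` c k.*2.+1)%O.
Proof.
move=> c_anti; apply: antichain_lt => i j ij.
rewrite meetUl !meetUr !c_anti ?joinxx//; lia.
Qed.

End Antichains.

Lemma cvg0_tail_dominated {R : realType} (u v : nat -> R) :
  v n @[n --> \oo] --> (0 : R) ->
  (forall k, exists2 n, (k <= n)%N & `|u k| <= `|v n|) ->
  u k @[k --> \oo] --> (0 : R).
Proof.
move=> /cvgr0Pnorm_le v0 uv; apply/cvgr0Pnorm_le => e /v0[N _ vN].
exists N => // k Nk; have [n kn] := uv k.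
by move=> /le_trans; apply; apply: vN; exact: leq_trans kn.
Qed.

Lemma balancing_coefficient {R : realType} (y z : R) : `|y| <= `|z| ->
  exists2 s : R, `|s| <= 1 & y = s * z.
Proof.
have [->|z0] := eqVneq z 0.
  by rewrite normr0 normr_le0 => /eqP ->; exists 0; rewrite ?normr0 ?mulr0.
exists (y / z); last by rewrite divfK.
by rewrite normrM normfV ler_pdivrMr ?normr_gt0// mul1r.
Qed.

Section ConcentratedMeasures.
Context {d : Order.disp_t} {A : ctbDistrLatticeType d} {R : realType}.
Context (t : stone A).
Implicit Types (a b c x : A) (mu : A -> R) (e K : R).

(* Within [e], [mu] lives on [c] and on an atom at [t]. *)
Definition almost_supported c e mu :=
  forall x, (x <= ~` c)%O -> ~ stone_set x t -> `|mu x| <= e.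

Definition concentrated c e K mu :=
  [/\ is_measure mu, ~ stone_set c t, almost_supported c e mu &
      exists2 b, (b <= c)%O & K < `|mu b|].

Lemma almost_supportedS c c' e e' mu : (c <= c')%O -> e <= e' ->
  almost_supported c e mu -> almost_supported c' e' mu.
Proof.
move=> cc' ee' mu_c x xc' xt; apply: le_trans ee'; apply: mu_c => //.
by apply: le_trans xc' _; rewrite leC.
Qed.

Lemma almost_supportedI c c' e e' mu : is_measure mu ->
  almost_supported c e mu -> almost_supported c' e' mu ->
  almost_supported (c `&` c')%O (e + e') mu.
Proof.
move=> mmu mu_c mu_c' x xcc' xt; rewrite (measure_splitC c x mmu) addrC.
have xtI y : ~ stone_set (x `&` y)%O t by rewrite stone_setI => -[].
apply: le_trans (ler_normD _ _) _; apply: lerD.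
  by apply: mu_c; [exact: leIr|exact: xtI].
apply: mu_c'; last exact: xtI.
rewrite -disj_leC -meetA disj_leC; exact: xcc'.
Qed.

Lemma almost_supportedZ c e mu (r : R) : almost_supported c e mu ->
  almost_supported c (`|r| * e) (r *: mu).
Proof.
by move=> mu_c x xc xt; rewrite normrM ler_wpM2l//; apply: mu_c.
Qed.

Lemma almost_supportedB c e e' mu mu' : almost_supported c e mu ->
  almost_supported c e' mu' -> almost_supported c (e + e') (mu - mu').
Proof.
move=> mu_c mu'_c x xc xt; apply: le_trans (ler_normB _ _) _.
by apply: lerD; [apply: mu_c|apply: mu'_c].
Qed.

(* The supremum of [mu] over the elements not containing [t] is nearly attained
   at some [b]; [mu] is then small on such elements disjoint from [b]. *)
Lemma measure_le_near_point mu e : is_measure mu -> 0 < e ->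
  exists2 a, stone_set a t &
    forall x, (x <= a)%O -> ~ stone_set x t -> mu x <= e.
Proof.
move=> /is_measureP[muU [C muC]] e_gt0.
pose S : set R := [set mu x | x in [set x | ~ stone_set x t]].
have ubS : has_ubound S.
  by exists C => _ [x _ <-]; apply: le_trans (ler_norm _) (muC x).
have supS : has_sup S.
  by split=> //; exists (mu \bot%O), \bot%O => //=; rewrite stone_set0.
have [_ [b bt <-] b_sup] := sup_adherent e_gt0 supS.
exists (~` b)%O => [|x xb xt]; first by rewrite stone_setC.
have bx0 : (b `&` x = \bot)%O by apply/eqP; rewrite meetC disj_leC.
have : S (mu (b `|` x)%O).
  by exists (b `|` x)%O => //=; rewrite stone_setU => -[].
by move=> /(ub_le_sup ubS); rewrite muU//; lra.
Qed.

Lemma almost_supported_near_point mu e : is_measure mu -> 0 < e ->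
  exists2 a, stone_set a t & almost_supported (~` a)%O e mu.
Proof.
move=> mmu e_gt0; have mNmu := is_measureZ (-1) mmu.
have [a ta mu_a] := measure_le_near_point mmu e_gt0.
have [a' ta' mu_a'] := measure_le_near_point mNmu e_gt0.
exists (a `&` a')%O; first by rewrite stone_setI.
move=> x; rewrite complK lexI => /andP[xa xa'] xt.
rewrite ler_norml lerNl mu_a// andbT -mulN1r; exact: mu_a'.
Qed.

Lemma almost_supported_mrestrict c e mu : is_measure mu ->
  mu (~` c)%O = 0 -> almost_supported c e mu ->
  forall x, `|mrestrict mu c x - mu x| <= e.
Proof.
move=> mmu mu_Cc mu_c x.
rewrite distrC (measure_splitC c x mmu) /mrestrict meetC addrAC subrr add0r.
have [xt|xt] := pselect (stone_set x t); last first.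
  by apply: mu_c; [exact: leIr|rewrite stone_setI => -[]].
have /eqP := measure_splitC x (~` c)%O mmu.
rewrite mu_Cc eq_sym addr_eq0 meetC => /eqP ->; rewrite normrN.
by apply: mu_c; [exact: leIl|rewrite stone_setI !stone_setC => -[_]; apply].
Qed.

Lemma cvg0_mrestrict (mu : nat -> A -> R) (c : nat -> A) (e : nat -> R) x :
  (forall k, is_measure (mu k)) -> (forall k, mu k (~` c k)%O = 0) ->
  (forall k, almost_supported (c k) (e k) (mu k)) ->
  e k @[k --> \oo] --> (0 : R) -> mu k x @[k --> \oo] --> (0 : R) ->
  mrestrict (mu k) (c k) x @[k --> \oo] --> (0 : R).
Proof.
move=> mmu mu_Cc mu_c e0 mu0; apply: cvg_sub0 mu0.
apply: (cvg0_tail_dominated e0) => k; exists k => //.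
apply: le_trans (ler_norm _).
exact: almost_supported_mrestrict (mmu k) (mu_Cc k) (mu_c k) x.
Qed.

Lemma concentrated_cancel c c' e K mu mu' : (c `&` c' = \bot)%O ->
  concentrated c e K mu -> concentrated c' e K mu' ->
  exists nu, [/\ concentrated (c `|` c')%O (e + e) (K - e) nu,
    nu (~` (c `|` c'))%O = 0 & forall x, `|nu x| <= `|mu x| + `|mu' x|].
Proof.
wlog mu_le : c c' mu mu' / `|mu (~` (c `|` c'))%O| <= `|mu' (~` (c `|` c'))%O|.
  move=> cancel cc' mu_c mu'_c'; have [le_mu|/ltW le_mu'] :=
    leP `|mu (~` (c `|` c'))%O| `|mu' (~` (c `|` c'))%O|.
    exact: cancel.
  rewrite joinC in le_mu' *; rewrite meetC in cc'.
  have [nu [nu_c nu0 nu_le]] := cancel _ _ _ _ le_mu' cc' mu'_c' mu_c.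
  by exists nu; split=> // x; rewrite addrC.
move=> cc' [mmu ct mu_c [b bc b_big]] [mmu' c't mu'_c' _].
have e_ge0 : 0 <= e.
  by apply: le_trans (normr_ge0 _) (mu_c \bot%O (le0x _) _); rewrite stone_set0.
have [s s_le1 sE] := balancing_coefficient mu_le.
have s_small (y : R) : `|s * y| <= `|y| by rewrite normrM ler_piMl.
exists (mu - s *: mu'); split; first split.
- by apply: is_measureB => //; apply: is_measureZ.
- by rewrite stone_setU => -[].
- apply: almost_supportedB.
    by apply: almost_supportedS mu_c => //; exact: leUl.
  apply: almost_supportedS (almost_supportedZ s mu'_c'); first exact: leUr.
  by rewrite ler_piMl.
- exists b; first by rewrite lexU2// bc.
  have mu'_b : `|mu' b| <= e.
    apply: mu'_c'; last by move=> /(stone_setS bc).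
    by apply: le_trans bc _; rewrite -disj_leC cc'.
  have := lerB_dist (mu b) (s * mu' b); have := s_small (mu' b).
  by rewrite !fctE; lra.
- by rewrite !fctE sE subrr.
- move=> x; apply: le_trans (ler_normB _ _) _; rewrite lerD2l; exact: s_small.
Qed.

End ConcentratedMeasures.

Section ConcentrationPoint.
Context {d : Order.disp_t} {A : ctbDistrLatticeType d} {R : realType}.
Context (mu : nat -> A -> R) (t : stone A).
Hypothesis (mmu : forall n, is_measure (mu n)).
Hypothesis (tmu : strong_nikodym_point mu t).
Implicit Types (a b x : A) (K : R) (lam : A -> R).

Definition tail_dominated k lam :=
  exists2 n, (k <= n)%N & forall x, `|lam x| <= `|mu n x|.

Lemma strong_nikodym_point_large K a : stone_set a t ->
  exists n b, [/\ (b <= a)%O, ~ stone_set b t &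
    exists M, [/\ 1 <= M, almost_supported t a M (mu n) & K * M < `|mu n b| ]].
Proof.
move=> /(tmu (Num.truncn K).+1)[U [n [clU Ua]]].
set N := _%:R; have KN : K < N by exact: truncnS_gt.
set V := variation_norm _.
have leV x : (x <= ~` a)%O -> (`|mu n x|%:E <= V)%E.
  exact: le_variation_norm_mrestrict.
have : (V < +oo)%E by case: (is_measure_mrestrict (~` a)%O (mmu n)).
have : (0 <= V)%E by apply: le_trans (leV \bot%O (le0x _)); rewrite lee_fin.
case: V leV => // v lev v_ge0 _; rewrite -EFinD -EFinM lte_fin => U_big.
have {clU} [b Ub] := clopen_stone_set clU.
have {}Ub : U = stone_set (b `&` a)%O.
  by rewrite stone_setI -Ub; apply/esym/setIidl => s /Ua[].
have v1_gt0 : 0 < v + 1 by apply: ltr_wpDl.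
have {}U_big : N * (v + 1) < `|mu n (b `&` a)%O|.
  have [[_ mE]|m0] := radon_extensionP (mu n); first by rewrite -mE -Ub.
  by move: U_big; rewrite m0 normr0 ltNge mulr_ge0// ltW.
exists n, (b `&` a)%O; split; first exact: leIr.
  by rewrite -/(stone_set _ t) -Ub => /Ua[_]; apply.
exists (v + 1); split=> [|x xa _|]; first by rewrite lerDr.
  by have := lev x xa; rewrite lee_fin => /le_trans; apply; rewrite lerDl.
by apply: lt_trans U_big; rewrite ltr_pM2r.
Qed.

Lemma strong_nikodym_point_large_tail k K a : stone_set a t ->
  exists n b, [/\ (k <= n)%N, (b <= a)%O, ~ stone_set b t &
    exists M, [/\ 1 <= M, almost_supported t a M (mu n) & K * M < `|mu n b| ]].
Proof.
move=> ta; have [C C_ge0 muC] := measures_bounded k mmu.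
have [n [b [ba bt [M [M_ge1 mu_a b_big]]]]] :=
  strong_nikodym_point_large (Num.max C K) ta.
have M_ge0 : 0 <= M by lra.
exists n, b; split=> //; last first.
  exists M; split=> //; apply: le_lt_trans b_big.
  by rewrite ler_wpM2r// le_max lexx orbT.
rewrite leqNgt; apply/negP => nk.
have := muC n b nk; rewrite leNgt => /negP; apply; apply: le_lt_trans b_big.
apply: (@le_trans _ _ (Num.max C K)); first by rewrite le_max lexx.
by rewrite ler_peMr// le_max C_ge0.
Qed.

Lemma concentrated_diff_near_point k (e : R) K a :
  0 < e <= 1 -> stone_set a t ->
  exists lam a', [/\ stone_set a' t, (a' <= a)%O,
    concentrated t (a `\` a')%O e K lam & tail_dominated k lam].
Proof.
move=> /andP[e_gt0 e_le1] ta; have e2_gt0 : 0 < e / 2 by lra.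
have [n [b [kn ba bt [M [M_ge1 mu_a b_big]]]]] :=
  strong_nikodym_point_large_tail k (K / (e / 2)) ta.
have M_gt0 : 0 < M by lra.
pose r := e / 2 / M; pose lam := r *: mu n.
have r_gt0 : 0 < r by rewrite divr_gt0.
have rM : `|r| * M = e / 2 by rewrite gtr0_norm// divfK// gt_eqF.
have mlam : is_measure lam := is_measureZ r (mmu n).
have [u tu lam_u] := almost_supported_near_point t mlam e2_gt0.
pose a' := (u `&` (a `\` b))%O.
have ta' : stone_set a' t by rewrite /a' diffE !stone_setI stone_setC.
exists lam, a'; split=> //.
- by rewrite /a' diffE leIxr// leIl.
- split=> //.
  + by rewrite diffE stone_setI stone_setC => -[].
  + rewrite diffE (splitr e); apply: almost_supportedI => //.
      by rewrite -rM; apply: almost_supportedZ.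
    by apply: almost_supportedS lam_u => //; rewrite leC leIl.
  + exists b; first by rewrite diffE lexI ba /a' complI complB !lexUr.
    rewrite normrM gtr0_norm// mulrAC ltr_pdivlMr//.
    by rewrite [ltRHS]mulrC -ltr_pdivrMr// mulrAC.
- exists n => // x; rewrite normrM gtr0_norm// ler_piMl// ler_pdivrMr//; lra.
Qed.

Lemma concentrated_antichain (e K : nat -> R) : (forall k, 0 < e k <= 1) ->
  exists (lam : nat -> A -> R) c, [/\ antichain c,
    forall k, concentrated t (c k) (e k) (K k) (lam k) &
    forall k, tail_dominated k (lam k)].
Proof.
move=> e01.
have /choice[step stepP] (ka : nat * {a | stone_set a t}) :
    exists p : (A -> R) * {a | stone_set a t},
    [/\ (sval p.2 <= sval ka.2)%O,
      concentrated t (sval ka.2 `\` sval p.2)%O (e ka.1) (K ka.1) p.1 &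
      tail_dominated ka.1 p.1].
  case: ka => k [a ta].
  have [lam [a' [ta' a'a conc dom]]] :=
    concentrated_diff_near_point k (K k) (e01 k) ta.
  by exists (lam, exist _ a' ta').
have tT : stone_set \top%O t by rewrite stone_setT.
pose a := fix a k : {a | stone_set a t} :=
  if k is j.+1 then (step (j, a j)).2 else exist _ \top%O tT.
pose lam k := (step (k, a k)).1.
have a_lamP k : [/\ (sval (a k.+1) <= sval (a k))%O,
    concentrated t (sval (a k) `\` sval (a k.+1))%O (e k) (K k) (lam k) &
    tail_dominated k (lam k)].
  exact: stepP (k, a k).
exists lam, (fun k => sval (a k) `\` sval (a k.+1))%O.
split=> [|k|k]; [|by case: (a_lamP k)|by case: (a_lamP k)].
by apply: (@antichain_decreasing_diff _ _ (sval \o a)) => k; case: (a_lamP k).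
Qed.

Lemma concentrated_antichain_cancel (e K : nat -> R) :
  (forall x, mu n x @[n --> \oo] --> (0 : R)) -> (forall k, 0 < e k <= 1) ->
  exists (nu : nat -> A -> R) c, [/\ antichain c,
    forall x, nu k x @[k --> \oo] --> (0 : R),
    forall k, nu k (~` c k)%O = 0 &
    forall k, concentrated t (c k) (e k + e k) (K k - e k) (nu k)].
Proof.
move=> mu0 e01.
have [lam [c [c_anti conc dom]]] :=
  concentrated_antichain (K \o half) (fun k => e01 k./2).
have /choice[nu nuP] k : exists nu,
    [/\ concentrated t (c k.*2 `|` c k.*2.+1)%O (e k + e k) (K k - e k) nu,
      nu (~` (c k.*2 `|` c k.*2.+1))%O = 0 &
      forall x, `|nu x| <= `|lam k.*2 x| + `|lam k.*2.+1 x|].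
  have := conc k.*2.+1; have := conc k.*2.
  rewrite /= uphalf_double doubleK; apply: concentrated_cancel.
  by apply: c_anti; lia.
exists nu, (fun k => c k.*2 `|` c k.*2.+1)%O.
split=> [|x|k|k]; [exact: antichain_join_pairs| |by case: (nuP k)..].
have lam0 (s : nat -> nat) : (forall k, (k <= s k)%N) ->
    `|lam (s k) x| @[k --> \oo] --> (0 : R).
  move=> le_s; apply: (cvg0_tail_dominated (mu0 x)) => k.
  have [n sn lam_mu] := dom (s k).
  by exists n; rewrite ?normr_id// (leq_trans (le_s k)).
have lam_pair0 : `|lam k.*2 x| + `|lam k.*2.+1 x| @[k --> \oo] --> (0 : R).
  by rewrite -[X in _ --> X]addr0; apply: cvgD; apply: lam0 => k; lia.
apply: (cvg0_tail_dominated lam_pair0) => k; exists k => //.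
by have [_ _ nu_le] := nuP k; rewrite [X in _ <= X]ger0_norm// addr_ge0.
Qed.

End ConcentrationPoint.

Theorem theorem3p18 (R : realType) (d : Order.disp_t)
    (A : ctbDistrLatticeType d) (infA : infinite_set [set: A])
    (hA : exists mu : nat -> A -> R,
        anti_nikodym mu /\ exists t : stone A, strong_nikodym_point mu t) :
  exists (nu : nat -> A -> R) (B : nat -> A),
    [/\ anti_nikodym nu, antichain B &
        forall k : nat,
          radon_support (radon_extension (nu k)) `<=` stone_set (B k) /\
          (k%:R%:E < variation_norm (nu k))%E].
Proof.
have [mu [[mmu mu0 _] [t tmu]]] := hA.
have inv01 k : 0 < (k.+1%:R^-1 : R) <= 1.
  by rewrite invr_gt0 ltr0n invf_le1// ler1n.
have [kap [B [B_anti kap0 kapCB kapP]]] :=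
  concentrated_antichain_cancel mmu tmu (fun k => k.+1%:R) mu0 inv01.
have mkap k : is_measure (kap k) by case: (kapP k).
have nu_big k : (k%:R%:E < variation_norm (mrestrict (kap k) (B k)))%E.
  have [_ _ _ [b bB b_big]] := kapP k.
  apply: lt_le_trans (le_variation_norm_mrestrict _ bB); rewrite lte_fin.
  apply: le_lt_trans b_big; rewrite lerBrDr -[leRHS]natr1 lerD2l.
  by case/andP: (inv01 k).
have error0 : k.+1%:R^-1 + k.+1%:R^-1 @[k --> \oo] --> (0 : R).
  by rewrite -[X in _ --> X]addr0; apply: cvgD; exact: cvg_harmonic.
exists (fun k => mrestrict (kap k) (B k)), B; split=> // [|k].
  apply: anti_nikodym_unbounded => // [k|x]; first exact: is_measure_mrestrict.
  apply: (cvg0_mrestrict mkap kapCB _ error0 (kap0 x)) => k.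
  by case: (kapP k) => _ _ kapB _; exact: kapB.
by split=> //; exact: radon_support_mrestrict.
Qed.
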